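(* Let $R$ be an associative unital ring, let $\delta : R \to R$ be an additive map with $\delta(1)=0$, and let $D = R[X; \mathrm{id}_R, \delta]$ be the corresponding non-associative differential polynomial ring. Suppose that all positive integers are regular in $R$. If $R$ is $\delta$-simple but $\delta$ is not a derivation, then $D$ is simple.
   Context: Rings are unital but not necessarily associative unless stated. Ideals are two-sided; a ring is simple if $\{0\}$ and the ring itself are its only ideals. A positive integer $n$ is regular in $R$ if $nr=0$ with $r\in R$ implies $r=0$. An ideal $I$ of $R$ is $\delta$-invariant if $\delta(I)\subseteq I$; $R$ is $\delta$-simple if $\{0\}$ and $R$ are its only $\delta$-invariant ideals. The map $\delta$ is a derivation if $\delta(rs)=r\delta(s)+\delta(r)s$ for all $r,s\in R$. $R[X;\mathrm{id}_R,\delta]$ is the set of formal polynomials $\sum_i r_i X^i$ ($r_i\in R$) with the usual addition and with multiplication the biadditive extension of $aX^m \cdot bX^n = \sum_{i=0}^m \binom{m}{i} a\,\delta^{m-i}(b) X^{i+n}$, for $a,b\in R$, $m,n\in\mathbb{N}$; it is a (not necessarily associative) unital ring. *)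

(* Defs.v *)
From mathcomp Require Import all_boot all_order all_algebra.
From mathcomp Require Import boolp classical_sets.

Set Implicit Arguments.
Unset Strict Implicit.
Unset Printing Implicit Defensive.

Import GRing.Theory.
Local Open Scope classical_set_scope.
Local Open Scope ring_scope.

(* Unital, not necessarily associative rings. The axioms do not exclude the
   zero ring. *)
Structure naRing := NaRing {
  na_sort :> zmodType;
  na_mul : na_sort -> na_sort -> na_sort;
  na_one : na_sort;
  na_mul1r : left_id na_one na_mul;
  na_mulr1 : right_id na_one na_mul;
  na_mulrDl : left_distributive na_mul +%R;
  na_mulrDr : right_distributive na_mul +%R
}.

Definition naRing_of_ring (R : pzRingType) : naRing :=
  @NaRing R *%R 1 (@mul1r R) (@mulr1 R) (@mulrDl R) (@mulrDr R).

(* Ideals are Prop-valued sets: boolean predicates would only range over the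
   decidable ideals. *)
Definition ideal (A : naRing) (I : set A) : Prop :=
  [/\ I 0,
      forall x y, I x -> I y -> I (x - y),
      forall a x, I x -> I (na_mul a x)
    & forall a x, I x -> I (na_mul x a)].

Definition simple (A : naRing) : Prop :=
  forall I : set A, ideal I -> I = [set 0] \/ I = setT.

Definition regular (V : zmodType) (n : nat) : Prop :=
  forall r : V, r *+ n = 0 -> r = 0.

Definition delta_invariant (T : Type) (delta : T -> T) (I : set T) : Prop :=
  delta @` I `<=` I.

Definition delta_simple (R : pzRingType) (delta : R -> R) : Prop :=
  forall I : set R, @ideal (naRing_of_ring R) I -> delta_invariant delta I ->
    I = [set 0] \/ I = setT.

Definition derivation (R : pzRingType) (delta : R -> R) : Prop :=
  forall r s, delta (r * s) = r * delta s + delta r * s.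

(* {poly R} requires R to be nontrivial; over the zero ring every map is a
   derivation, so a statement about non-derivations loses nothing. *)
Section DiffPoly.
Variables (R : nzRingType) (delta : {additive R -> R}).

(* The product of a X^m and b X^n. *)
Definition dmul_mon (a : R) (m : nat) (b : R) (n : nat) : {poly R} :=
  \sum_(i < m.+1) (a * iter (m - i) delta b *+ 'C(m, i)) *: 'X^(i + n).

Definition dmul (p q : {poly R}) : {poly R} :=
  \sum_(m < size p) \sum_(n < size q) dmul_mon p`_m m q`_n n.

Lemma iter_deltaD k : {morph iter k delta : x y / x + y}.
Proof. by elim: k => // k IH x y /=; rewrite IH raddfD. Qed.

Lemma iter_delta0 k : iter k delta 0 = 0.
Proof. by elim: k => //= k ->; rewrite raddf0. Qed.

Lemma dmul_mon0l m b n : dmul_mon 0 m b n = 0.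
Proof. by rewrite /dmul_mon big1 // => i _; rewrite mul0r mul0rn scale0r. Qed.

Lemma dmul_mon0r a m n : dmul_mon a m 0 n = 0.
Proof.
by rewrite /dmul_mon big1 // => i _; rewrite iter_delta0 mulr0 mul0rn scale0r.
Qed.

Lemma dmul_monDl m b n : {morph (fun a => dmul_mon a m b n) : x y / x + y}.
Proof.
move=> x y; rewrite /dmul_mon -big_split /=; apply: eq_bigr => i _.
by rewrite mulrDl mulrnDl scalerDl.
Qed.

Lemma dmul_monDr a m n : {morph (fun b => dmul_mon a m b n) : x y / x + y}.
Proof.
move=> x y; rewrite /dmul_mon -big_split /=; apply: eq_bigr => i _.
by rewrite iter_deltaD mulrDr mulrnDl scalerDl.
Qed.

Lemma dmul_widen M N (p q : {poly R}) : (size p <= M)%N -> (size q <= N)%N ->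
  dmul p q = \sum_(m < M) \sum_(n < N) dmul_mon p`_m m q`_n n.
Proof.
move=> leM leN; rewrite /dmul.
rewrite (big_ord_widen M (fun m => \sum_(n < size q) dmul_mon p`_m m q`_n n)) //.
rewrite big_mkcond /=; apply: eq_bigr => m _; case: ltnP => [_|lem].
  rewrite (big_ord_widen N (fun n => dmul_mon p`_m m q`_n n)) // big_mkcond /=.
  apply: eq_bigr => n _; case: ltnP => // len.
  by rewrite (nth_default _ len) dmul_mon0r.
by rewrite big1 // => n _; rewrite (nth_default _ lem) dmul_mon0l.
Qed.

Lemma dmulDl : left_distributive dmul +%R.
Proof.
move=> p1 p2 q; set M := maxn (size p1) (size p2).
rewrite !(@dmul_widen M (size q)) ?leq_maxl ?leq_maxr ?size_polyD //.
rewrite -big_split /=; apply: eq_bigr => m _.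
rewrite -big_split /=; apply: eq_bigr => n _.
by rewrite coefD dmul_monDl.
Qed.

Lemma dmulDr : right_distributive dmul +%R.
Proof.
move=> p q1 q2; set N := maxn (size q1) (size q2).
rewrite !(@dmul_widen (size p) N) ?leq_maxl ?leq_maxr ?size_polyD //.
rewrite -big_split /=; apply: eq_bigr => m _.
rewrite -big_split /=; apply: eq_bigr => n _.
by rewrite coefD dmul_monDr.
Qed.

Lemma dmulZXn a m b n : dmul (a *: 'X^m) (b *: 'X^n) = dmul_mon a m b n.
Proof.
have szZX (c : R) k : (size (c *: 'X^k) <= k.+1)%N.
  by rewrite (leq_trans (size_scale_leq _ _)) ?size_polyXn.
rewrite (dmul_widen (szZX a m) (szZX b n)).
rewrite (bigD1 ord_max) //= [X in _ + X]big1 ?addr0; last first.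
  move=> i ne_im; rewrite big1 // => j _; rewrite coefZ coefXn.
  by rewrite -val_eqE /= in ne_im; rewrite (negbTE ne_im) mulr0 dmul_mon0l.
rewrite (bigD1 ord_max) //= [X in _ + X]big1 ?addr0; last first.
  move=> j ne_jn; rewrite !coefZ !coefXn.
  by rewrite -val_eqE /= in ne_jn; rewrite (negbTE ne_jn) mulr0 dmul_mon0r.
by rewrite !coefZ !coefXn !eqxx !mulr1.
Qed.

Lemma dmul1r : left_id 1 dmul.
Proof.
move=> p.
rewrite (@dmul_widen 1 (size p)) ?size_poly1 // big_ord1 /=.
rewrite -[RHS]coefK poly_def; apply: eq_bigr => n _.
by rewrite /dmul_mon big_ord1 coef1 /= bin0 mul1r mulr1n add0n.
Qed.

Hypothesis delta1 : delta 1 = 0.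

Lemma iter_delta1 k : iter k.+1 delta 1 = 0.
Proof. by elim: k => //= k ->; rewrite raddf0. Qed.

Lemma dmulr1 : right_id 1 dmul.
Proof.
move=> p; rewrite (@dmul_widen (size p) 1) ?size_poly1 //.
rewrite -[RHS]coefK poly_def; apply: eq_bigr => m _.
rewrite big_ord1 coef1 /= /dmul_mon big_ord_recr /= subnn binn mulr1 addn0.
rewrite big1 ?add0r // => i _; rewrite -(subnSK (ltn_ord i)) iter_delta1.
by rewrite mulr0 mul0rn scale0r.
Qed.

(* R[X; id_R, delta]: the additive group and coefficients of {poly R}, with
   dmul in place of the product of {poly R}. By dmulDl, dmulDr and dmulZXn, dmul
   is the biadditive extension of the product of monomials dmul_mon. *)
Definition diffpoly : naRing :=
  @NaRing {poly R} dmul 1 dmul1r dmulr1 dmulDl dmulDr.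

End DiffPoly.

(* Main.v *)
Require Import Defs.
From mathcomp Require Import all_boot all_order all_algebra.
From mathcomp Require Import boolp classical_sets.

Import GRing.Theory.
Local Open Scope ring_scope.

(** Let [I] be a nonzero ideal of [D] and let [n] be the least degree of a
    nonzero element of [I]. The coefficients of [X^n] in the elements of [I] of
    degree at most [n] form an ideal of [R] ([ideal_coefs_at]), and it is
    [delta]-invariant because [X f - f X] is obtained by applying [delta] to the
    coefficients of [f] ([dmulX_comm]). By [delta]-simplicity it contains [1], so
    [I] contains a monic [f] of degree [n] ([ideal_monic_minimal]).

    For [r] in [R], both [r f] and [f r] lie in [I] and have [r] as coefficient of
    [X^n], so [r f - f r] has degree less than [n] and vanishes by minimality. If
    [n > 0], comparing the coefficients of [X^(n-1)] in [r f = f r] gives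
    [r a = a r + n delta r], where [a] is the coefficient of [X^(n-1)] in [f].
    Hence [n delta] is the inner derivation [r |-> r a - a r], and as [n] is
    regular, [delta] itself is a derivation ([derivation_of_commuting_monic]), which
    is excluded. So [n = 0], [f = 1] and [I = D]. *)

Section DiffPolyIdeals.
Context {R : nzRingType} (delta : {additive R -> R}).
Implicit Types (p q f : {poly R}) (c : R).

Lemma dmulCl c q : dmul delta c%:P q = c *: q.
Proof.
rewrite (@dmul_widen _ _ 1 (size q)) ?size_polyC_leq1 // big_ord1 /=.
rewrite -[in RHS](coefK q) poly_def scaler_sumr; apply: eq_bigr => n _.
by rewrite /dmul_mon big_ord1 coefC /= bin0 mulr1n add0n scalerA.
Qed.

(** In [p c] the term [p_m X^m c] contributes
    [C(m, k) p_m delta^(m-k)(c)] to [X^k]; the terms with [m < k] are harmless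
    since their binomial coefficient is [0]. *)
Lemma coef_dmulCr p c M k : (size p <= M)%N ->
  (dmul delta p c%:P)`_k =
    \sum_(m < M) p`_m * iter (m - k) delta c *+ 'C(m, k).
Proof.
move=> leM; rewrite (@dmul_widen _ _ M 1) ?size_polyC_leq1 // coef_sum.
apply: eq_bigr => m _; rewrite big_ord1 coefC /= /dmul_mon coef_sum.
have [le_km|lt_mk] := leqP k m.
  rewrite (bigD1 (Ordinal (le_km : (k < m.+1)%N))) //= big1 ?addr0.
    by rewrite addn0 coefZ coefXn eqxx mulr1.
  move=> i; rewrite -val_eqE /= => ne_ik.
  by rewrite coefZ coefXn addn0 eq_sym (negbTE ne_ik) mulr0.
rewrite bin_small // mulr0n big1 // => i _.
rewrite coefZ coefXn addn0 gtn_eqF ?mulr0 //.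
exact: leq_trans (ltn_ord i) lt_mk.
Qed.

Lemma size_dmulCr p c : (size (dmul delta p c%:P) <= size p)%N.
Proof.
apply/leq_sizeP => k le_pk; rewrite (@coef_dmulCr _ _ (size p)) // big1 // => m _.
by rewrite bin_small // (leq_trans (ltn_ord m)).
Qed.

Lemma coef_dmulCr_last p c n : (size p <= n.+1)%N ->
  (dmul delta p c%:P)`_n = p`_n * c.
Proof.
move=> le_pn; rewrite (coef_dmulCr _ _ _ _ le_pn) big_ord_recr /= subnn binn.
by rewrite big1 ?add0r // => m _; rewrite bin_small.
Qed.

Lemma coef_dmulCr_penultimate p c n : (size p <= n.+2)%N ->
  (dmul delta p c%:P)`_n = p`_n * c + p`_n.+1 * delta c *+ n.+1.
Proof.
move=> le_pn; rewrite (coef_dmulCr _ _ _ _ le_pn) !big_ord_recr /= subnn binn.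
rewrite subSnn binSn /= big1 ?add0r // => m _.
by rewrite bin_small.
Qed.

Section Delta1.
Hypothesis delta1 : delta 1 = 0.

Lemma dmul_monr1 c m n : dmul_mon delta c m 1 n = c *: 'X^(m + n).
Proof.
rewrite /dmul_mon big_ord_recr /= subnn binn mulr1 big1 ?add0r // => i _.
by rewrite -(subnSK (ltn_ord i)) iter_delta1 // mulr0 mul0rn scale0r.
Qed.

(** On a monomial, [X (a X^n) = a X^(n+1) + delta(a) X^n], whereas
    [(a X^n) X = a X^(n+1)] since [delta] kills the coefficient of [X]. *)
Lemma dmulX_comm p :
  dmul delta 'X p - dmul delta p 'X = map_poly delta p.
Proof.
rewrite (@dmul_widen _ _ 2 (size p)) ?size_polyX //.
rewrite (@dmul_widen _ _ (size p) 2) ?size_polyX //.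
rewrite big_ord_recl big_ord1 /= -big_split -sumrB /=.
rewrite [RHS]poly_def; apply: eq_bigr => m _.
rewrite big_ord_recl big_ord1 /= !coefX /= dmul_mon0l dmul_mon0r dmul_monr1.
rewrite /dmul_mon big_ord_recl big_ord1 /= bin0 bin1 !mul1r !mulr1n !add0r.
by rewrite addn1 add0n add1n addrK.
Qed.

Local Notation D := (diffpoly delta1).

(** Elements of degree less than [n] are admitted, with coefficient [0]: this is
    what makes the set closed under subtraction and under products that kill the
    leading coefficient. *)
Definition coefs_at (I : set D) (n : nat) : set R :=
  [set a | exists f : {poly R}, [/\ I f, (size f <= n.+1)%N & f`_n = a]].

Lemma ideal_coefs_at (I : set D) n :
  ideal I -> @ideal (naRing_of_ring R) (coefs_at I n).
Proof.
move=> [I0 IB IMl IMr]; split.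
- by exists 0; rewrite size_poly0 coef0.
- move=> _ _ [f [If sf <-]] [g [Ig sg <-]]; exists (f - g).
  split; [exact: IB| |exact: coefB].
  by rewrite (leq_trans (size_polyD _ _)) // size_polyN geq_max sf.
- move=> a _ [f [If sf <-]]; exists (dmul delta a%:P f).
  split; first exact: (IMl a%:P f If).
    by rewrite dmulCl (leq_trans (size_scale_leq _ _)).
  by rewrite dmulCl coefZ.
- move=> a _ [f [If sf <-]]; exists (dmul delta f a%:P).
  split; first exact: (IMr a%:P f If).
    exact: leq_trans (size_dmulCr _ _) sf.
  exact: coef_dmulCr_last.
Qed.

Lemma delta_invariant_coefs_at (I : set D) n :
  ideal I -> delta_invariant delta (coefs_at I n).
Proof.
move=> [I0 IB IMl IMr] _ [_ [f [If sf <-]] <-]; exists (map_poly delta f); split.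
- rewrite -dmulX_comm.
  exact: (IB _ _ (IMl 'X f If) (IMr 'X f If)).
- exact: leq_trans (size_poly _ _) sf.
- exact: coef_map.
Qed.

(** With [n] the least degree in the ideal, the coefficients of [X^n] form a
    nonzero [delta]-invariant ideal of [R], hence [1] is among them. *)
Lemma ideal_monic_minimal (I : set D) :
  delta_simple delta -> ideal I -> I <> [set 0]%classic ->
  exists f : {poly R}, [/\ I f, f \is monic
    & forall g : {poly R}, I g -> (size g < size f)%N -> g = 0].
Proof.
move=> hsimple idI Inz.
have exn : exists n, `[< exists f : {poly R}, I f /\ size f = n.+1 >].
  apply: contrapT => noI; apply: Inz; apply/seteqP; split => [f If|_ ->].
    apply: contrapT => /eqP fn0; apply: noI; exists (size (f : {poly R})).-1.
    by apply/asboolP; exists f; split=> //; rewrite prednK // size_poly_gt0.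
  by case: idI.
case: (ex_minnP exn) => n /asboolP[g [Ig sg]] minn.
have min_size (h : {poly R}) : I h -> (size h < n.+1)%N -> h = 0.
  move=> Ih lt_hn; apply/eqP/contraT; rewrite -size_poly_gt0 => h_gt0.
  have /minn : `[< exists f : {poly R}, I f /\ size f = (size h).-1.+1 >].
    by apply/asboolP; exists h; rewrite prednK.
  by rewrite -ltnS prednK // leqNgt lt_hn.
have [J0|JT] := hsimple _ (ideal_coefs_at I n idI)
  (delta_invariant_coefs_at I n idI).
  have : coefs_at I n g`_n by exists g; rewrite sg.
  have -> : g`_n = lead_coef g by rewrite lead_coefE sg.
  rewrite J0 => /eqP; rewrite lead_coef_eq0 -size_poly_eq0 => /eqP.
  by rewrite sg.
have : coefs_at I n 1 by rewrite JT.
move=> [f [If sf fn1]].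
have size_f : size f = n.+1.
  apply/eqP; rewrite eqn_leq sf /=; apply: contraT.
  rewrite -ltnNge => /(min_size f If) f0.
  by move/eqP: fn1; rewrite f0 coef0 eq_sym oner_eq0.
exists f; split=> //; last by rewrite size_f.
by rewrite monicE lead_coefE size_f fn1.
Qed.

(** The difference [r f - f r] lies in the ideal, and its coefficient in the
    degree of [f] is [r - r = 0]. *)
Lemma minimal_monic_commutes (I : set D) f : ideal I -> I f -> f \is monic ->
  (forall g : {poly R}, I g -> (size g < size f)%N -> g = 0) ->
  forall r, dmul delta r%:P f = dmul delta f r%:P.
Proof.
move=> [_ IB IMl IMr] If fmon minf r; apply/subr0_eq/minf.
  exact: (IB _ _ (IMl r%:P f If) (IMr r%:P f If)).
have f_gt0 : (0 < size f)%N by rewrite size_poly_gt0 monic_neq0.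
have fn1 : f`_(size f).-1 = 1 by rewrite -lead_coefE (monicP fmon).
rewrite -[X in (_ < X)%N](prednK f_gt0) ltnS; apply/leq_sizeP => k.
rewrite leq_eqVlt => /orP[/eqP <-|].
  rewrite coefB dmulCl coefZ coef_dmulCr_last ?prednK // fn1.
  by rewrite mulr1 mul1r subrr.
rewrite prednK // => le_fk.
rewrite coefB dmulCl coefZ (nth_default _ le_fk) mulr0 sub0r.
by rewrite nth_default ?oppr0 // (leq_trans (size_dmulCr _ _)).
Qed.

End Delta1.

(** The coefficients of [X^n] in [r f = f r] say that [(n+1) delta] is the inner
    derivation given by the coefficient of [X^n] in [f]. *)
Lemma derivation_of_commuting_monic f n :
  regular R n.+1 -> size f = n.+2 -> f \is monic ->
  (forall r, dmul delta r%:P f = dmul delta f r%:P) ->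
  derivation delta.
Proof.
move=> reg_n size_f fmon fC.
have inner r : delta r *+ n.+1 = r * f`_n - f`_n * r.
  have /(congr1 (fun p : {poly R} => p`_n)) := fC r.
  rewrite dmulCl coefZ coef_dmulCr_penultimate ?size_f //.
  have -> : f`_n.+1 = 1 by move/monicP: fmon; rewrite lead_coefE size_f.
  by rewrite mul1r => ->; rewrite addrC addKr.
move=> r s; apply/subr0_eq/reg_n.
rewrite mulrnBl mulrnDl -mulrnAr -mulrnAl !inner mulrBr mulrBl !mulrA.
by rewrite addrA subrK subrr.
Qed.

End DiffPolyIdeals.

Theorem theorem43 (R : nzRingType) (delta : {additive R -> R})
    (delta1 : delta 1 = 0)
    (hreg : forall n : nat, (0 < n)%N -> regular R n)
    (hsimple : delta_simple delta)
    (hder : ~ derivation delta) :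
  simple (diffpoly delta1).
Proof.
move=> I idI; have [I0|Inz] := pselect (I = [set 0]%classic); [by left|right].
have [f [If fmon minf]] := ideal_monic_minimal _ delta1 I hsimple idI Inz.
have fC := minimal_monic_commutes _ delta1 I f idI If fmon minf.
case size_f: (size f) => [|[|n]].
- by move: (monic_neq0 fmon); rewrite -size_poly_eq0 size_f.
- have f1 : f = 1.
    move/monicP: (fmon); rewrite lead_coefE size_f /= => f01.
    by rewrite (size1_polyC (eq_leq size_f)) f01.
  apply/seteqP; split=> // p _.
  have [_ _ IMl _] := idI; have := IMl p f If.
  by rewrite f1 (na_mulr1 (p : diffpoly delta1)).
- by case: hder; apply: derivation_of_commuting_monic (hreg n.+1 isT) size_f fmon fC.
Qed.
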